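(* If $Q$ is a finite extra loop with some associator not contained in $Z(Q)$, then $|A(Q)| \ge 32$ and $|Q : N(Q)| \ge 16$, so that $512 \mid |Q|$.
   Context: A loop is a set with a binary operation having a two-sided identity $1$ and such that for all $a,b$ the equations $ax=b$ and $ya=b$ have unique solutions. In products, juxtaposition binds more tightly than $\cdot$. An extra loop is a loop that is both conjugacy closed and Moufang; equivalently (and this may be taken as the definition) a loop satisfying the identity $(xy\cdot z)\cdot x = x\cdot(y\cdot zx)$. For $x,y,z$ in a loop $Q$ the associator $(x,y,z)\in Q$ is defined by $(x\cdot yz)\,(x,y,z)=xy\cdot z$, and $A(Q)$ is the subloop of $Q$ generated by all associators. The nucleus $N(Q)$ is the set of elements that associate with all pairs of elements of $Q$ in every position (in an extra loop it is a normal subloop, and $|Q:N(Q)|=|Q/N(Q)|$); the center $Z(Q)$ is the set of elements of $N(Q)$ that commute with every element of $Q$. *)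

(* Defs.v *)
From HB Require Import structures.
From mathcomp Require Import all_boot.

Set Implicit Arguments.
Unset Strict Implicit.
Unset Printing Implicit Defensive.

Local Open Scope group_scope.

HB.mixin Record UMagma_isLoop Q of UMagma Q := {
  ldiv_unique : forall a b : Q, exists! x, a * x = b;
  rdiv_unique : forall a b : Q, exists! y, y * a = b
}.

#[short(type="loopType")]
HB.structure Definition Loop := {Q of UMagma_isLoop Q & UMagma Q}.

#[short(type="finLoopType")]
HB.structure Definition FinLoop := {Q of Loop Q & Finite Q}.

Bind Scope group_scope with Loop.sort FinLoop.sort.

(* A loop is an extra loop when (xy.z).x = x.(y.zx); this single identity is
   equivalent to being both conjugacy closed and Moufang. *)
Definition extra_loop (Q : loopType) : Prop :=
  forall x y z : Q, ((x * y) * z) * x = x * (y * (z * x)).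

Section Division.
Variable Q : loopType.
Implicit Types a b x y z : Q.

Fact ldiv_subproof a b : exists x, a * x == b.
Proof. by have [x [abx _]] := ldiv_unique a b; exists x; apply/eqP. Qed.

Fact rdiv_subproof b a : exists y, y * a == b.
Proof. by have [y [yab _]] := rdiv_unique a b; exists y; apply/eqP. Qed.

(* ldiv a b is a \ b, the solution x of a x = b;
   rdiv b a is b / a, the solution y of y a = b. *)
Definition ldiv a b : Q := xchoose (ldiv_subproof a b).
Definition rdiv b a : Q := xchoose (rdiv_subproof b a).

Lemma mul_ldiv a b : a * ldiv a b = b.
Proof. exact/eqP/(xchooseP (ldiv_subproof a b)). Qed.

Lemma mul_rdiv b a : rdiv b a * a = b.
Proof. exact/eqP/(xchooseP (rdiv_subproof b a)). Qed.

Lemma ldiv_eq a b x : a * x = b -> x = ldiv a b.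
Proof.
have [u [_ uniq_u]] := ldiv_unique a b.
by move=> abx; rewrite -(uniq_u _ abx) -(uniq_u _ (mul_ldiv a b)).
Qed.

Lemma rdiv_eq b a y : y * a = b -> y = rdiv b a.
Proof.
have [u [_ uniq_u]] := rdiv_unique a b.
by move=> yab; rewrite -(uniq_u _ yab) -(uniq_u _ (mul_rdiv b a)).
Qed.

Definition associator x y z : Q := ldiv (x * (y * z)) ((x * y) * z).

Lemma associatorE x y z : (x * (y * z)) * associator x y z = (x * y) * z.
Proof. exact: mul_ldiv. Qed.

End Division.

Section FinLoopSets.
Variable Q : finLoopType.
Implicit Types (S T : {set Q}) (a x y z : Q).

Definition subloop S : bool :=
  (1 \in S) &&
  [forall x in S, forall y in S,
     [&& x * y \in S, ldiv x y \in S & rdiv x y \in S]].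

Definition subloop_gen S : {set Q} :=
  \bigcap_(T : {set Q} | subloop T && (S \subset T)) T.

Lemma subloop_genP S : subloop (subloop_gen S).
Proof.
have subP T : subloop T -> 1 \in T /\ {in T &, forall x y,
    [/\ x * y \in T, ldiv x y \in T & rdiv x y \in T]}.
  case/andP=> T1 /forall_inP TP; split=> // x y Tx Ty.
  by have /forall_inP/(_ y Ty)/and3P := TP x Tx.
apply/andP; split; first by apply/bigcapP=> T /andP[/subP[]].
apply/forall_inP=> x /bigcapP Sx; apply/forall_inP=> y /bigcapP Sy.
by apply/and3P; split; apply/bigcapP=> T PT; have /andP[/subP[_ TP] _] := PT;
   have [] := TP x y (Sx T PT) (Sy T PT).
Qed.

Lemma sub_subloop_gen S : S \subset subloop_gen S.
Proof. by apply/bigcapsP=> T /andP[]. Qed.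

Lemma subloop_gen_min S T : subloop T -> S \subset T -> subloop_gen S \subset T.
Proof. by move=> subT ST; apply: bigcap_inf; rewrite subT. Qed.

Definition associators : {set Q} :=
  [set a | [exists x, exists y, exists z, a == associator x y z]].

Definition associator_subloop : {set Q} := subloop_gen associators.

Definition nucleus : {set Q} :=
  [set a | [forall x, forall y,
     [&& (a * x) * y == a * (x * y),
         (x * a) * y == x * (a * y)
       & (x * y) * a == x * (y * a)]]].

Definition center : {set Q} :=
  [set a in nucleus | [forall x, a * x == x * a]].

(* The number of left cosets x S in Q. When S is a normal subloop these are
   exactly the elements of Q / S. *)
Definition loop_index S : nat := #|[set [set x * s | s in S] | x : Q]|.

End FinLoopSets.

Arguments associators : clear implicits.
Arguments associator_subloop : clear implicits.
Arguments nucleus : clear implicits.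
Arguments center : clear implicits.

(* Main.v *)
Require Import Defs.
From mathcomp Require Import all_boot.

Set Implicit Arguments.
Unset Strict Implicit.
Unset Printing Implicit Defensive.

(** In an extra loop Q every square is nuclear ([square_nucleus]) and the
  nucleus N is normal ([nucleusJ]).  Hence Q / N is a Moufang loop of exponent
  2, which forces it to be an elementary abelian 2-group ([eqNA], [eqNC]).  So
  the associator [x, y, z] lies in N and depends only on its arguments modulo
  N, which makes it central in N ([associatorC]).  Q acts on N by conjugation,
  a ^ x being x^-1 a x, and on associators this is an action of Q / N.

  The associator is a crossed homomorphism in its first argument,
  [z w, x, y] = [z, x, y] ^ w [w, x, y]   ([associator_mul1]),
  while the Moufang identity gives [y, z, x] = [x, y, z] ^ x.  Expanding
  [x x, y, z] = 1 turns the latter into [y, z, x] = [x, y, z]^-1; three cyclic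
  rotations then give [x, y, z] = [x, y, z]^-1.  So associators have exponent
  2, are invariant under cyclic rotations, and are fixed by their arguments.
  Comparing the expansions of [z w, x, y] = [w z, x, y] yields
  [z, x, y] ^ w [z, x, y] = [w, x, y] ^ z [w, x, y]  ([associator_swap_move]).

  Suppose now that [x, y, z] is not central.  It commutes with N, so some w
  moves it, and g = [x, y, z] ^ w [x, y, z] is not 1.  By the last identity
  each of the four elements x, y, z, w moves the associator of the other three
  (taken in a suitable order), with the same commutator g.  It fixes g and the
  other three associators, in which it occurs.  Reading this duality both ways,
  x, y, z, w are independent modulo N, so 16 divides |Q : N|
  ([nucleus_index_dvd]), and the four associators together with g are
  independent involutions in N, so that they span 32 elements of A(Q), and 32
  divides |N| ([card_associators_span]).  Finally 512 = 16 * 32. *)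

(** * Extra loops are conjugacy closed Moufang loops with nuclear squares *)

Section ExtraIdentities.
Local Open Scope group_scope.
Variable Q : loopType.
Implicit Types u v w x y z n m : Q.

Lemma loop_mulI x : injective (fun y => x * y).
Proof.
by move=> y z /= xyz; rewrite (ldiv_eq xyz) -(ldiv_eq (erefl (x * z))).
Qed.

Lemma loop_Imul x : injective (fun y => y * x).
Proof.
by move=> y z /= xyz; rewrite (rdiv_eq xyz) -(rdiv_eq (erefl (z * x))).
Qed.

Definition linv x : Q := ldiv x 1.

(** Conjugation x^-1 n x, defined by division so as to make sense in any
  loop. *)
Definition lconj n x : Q := ldiv x (n * x).

Lemma lconjE n x : x * lconj n x = n * x.
Proof. exact: mul_ldiv. Qed.

Hypothesis extraQ : extra_loop Q.

Lemma mulV x : x * linv x = 1.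
Proof. exact: mul_ldiv. Qed.

Lemma flexible x y : (x * y) * x = x * (y * x).
Proof. by have := extraQ x 1 y; rewrite mulg1 mul1g. Qed.

Lemma mulVl x : linv x * x = 1.
Proof. by apply: (@loop_mulI x); rewrite /= -flexible mulV mul1g mulg1. Qed.

Lemma mulKV x w : x * (linv x * w) = w.
Proof.
by have := extraQ x (linv x) (rdiv w x); rewrite mul_rdiv mulV mul1g mul_rdiv.
Qed.

Lemma mulK x w : linv x * (x * w) = w.
Proof. by apply: (@loop_mulI x); rewrite /= mulKV. Qed.

Lemma mulVK x w : (w * linv x) * x = w.
Proof.
have := extraQ x (ldiv x w) (linv x).
by rewrite mul_ldiv mulVl mulg1 mul_ldiv.
Qed.

Lemma mulKr x w : (w * x) * linv x = w.
Proof. by apply: (@loop_Imul x); rewrite /= mulVK. Qed.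

Lemma linvK x : linv (linv x) = x.
Proof. by apply: (@loop_mulI (linv x)); rewrite /= mulV mulVl. Qed.

Lemma linvM x y : linv (x * y) = linv y * linv x.
Proof.
have e : linv (x * y) * x = linv y.
  by rewrite -{2}(mulKr y x) mulK.
by rewrite -e mulKr.
Qed.

(** The defining identity as an autotopism: left multiplication by x, right
  multiplication by x^-1, and their composite.  In a loop with the inverse
  property, the three maps of an autotopism may be permuted after conjugation
  by inversion; this yields both conjugacy closure laws below. *)
Lemma extra_autotopism x y z : (x * y) * (z * linv x) = (x * (y * z)) * linv x.
Proof. by apply: (@loop_Imul x); rewrite /= mulVK extraQ mulVK. Qed.

Lemma left_conjugacy_closed x u v :
  x * (u * v) = ((x * u) * linv x) * (x * v).
Proof.
have := extra_autotopism x (u * v) (linv v).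
by rewrite mulKr -linvM => <-; rewrite mulVK.
Qed.

Lemma linv_conj x u : linv (x * linv u) = u * linv x.
Proof. by rewrite linvM linvK. Qed.

Lemma right_conj_mul x u v :
  (u * v) * linv x = (u * linv x) * ((x * v) * linv x).
Proof.
have := extra_autotopism x (linv u) (u * v).
by rewrite mulK => <-; rewrite -(linv_conj x u) mulK.
Qed.

Lemma lconjV n x : lconj n x = (linv x * n) * x.
Proof. by apply: (@loop_mulI x); rewrite /= lconjE -flexible mulKV. Qed.

Lemma right_conjugacy_closed x u v : (u * v) * x = (u * x) * lconj v x.
Proof. by have := right_conj_mul (linv x) u v; rewrite linvK lconjV. Qed.

(** The autotopisms of left and right conjugacy closure compose to this one. *)
Lemma moufang x y z : (x * y) * (z * x) = (x * (y * z)) * x.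
Proof.
rewrite (left_conjugacy_closed x y z) (right_conjugacy_closed x (_ * linv x)).
by rewrite mulVK lconjV mulK.
Qed.

(** The Moufang autotopism and [extra_autotopism] agree on the first
  component, so their quotient is trivial there and says that squaring a right
  multiplication gives a right nuclear operator. *)
Lemma right_shift x y z : ((y * z) * x) * x = y * ((z * x) * x).
Proof.
have := extra_autotopism x y ((z * x) * x); rewrite mulKr moufang.
move/(congr1 (fun t => t * x)); rewrite mulVK.
by rewrite flexible flexible => /loop_mulI.
Qed.

Lemma right_alternative x y : (y * x) * x = y * (x * x).
Proof. by have := right_shift x y 1; rewrite mulg1 mul1g. Qed.

Lemma square_right_nuclear x y z : (y * z) * (x * x) = y * (z * (x * x)).
Proof. by rewrite -!right_alternative right_shift. Qed.

(** The right nuclear law of n read as an autotopism whose components are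
  permuted; it carries right nuclear elements to the middle nucleus. *)
Lemma middle_of_right n :
    (forall x y, (x * y) * n = x * (y * n)) ->
  forall x y, x * y = (x * n) * (linv n * y).
Proof.
move=> nN x y; apply: (@loop_Imul (linv y * n)); rewrite /= -nN mulKr.
by rewrite -[in linv n * _](linvK y) -linvM mulVK.
Qed.

End ExtraIdentities.

(** * The nucleus and the quotient by it *)

Section Nucleus.
Local Open Scope group_scope.
Variable Q : finLoopType.
Implicit Types u v w x y z n m a b : Q.
Local Notation N := (nucleus Q).

Lemma nucleusP n :
  reflect (forall x y, [/\ (n * x) * y = n * (x * y),
                           (x * n) * y = x * (n * y)
                         & (x * y) * n = x * (y * n)]) (n \in N).
Proof.
rewrite inE; apply: (iffP idP) => [/forallP nN x y | nN].
  by have /forallP/(_ y)/and3P[/eqP ? /eqP ? /eqP ?] := nN x.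
by apply/forallP=> x; apply/forallP=> y; have [-> -> ->] := nN x y; rewrite !eqxx.
Qed.

(* The suffix of nucl, nucm and nucr is the position of the nuclear factor. *)
Lemma nucl n x y : n \in N -> (n * x) * y = n * (x * y).
Proof. by move/nucleusP/(_ x y)=> []. Qed.

Lemma nucm n x y : n \in N -> (x * n) * y = x * (n * y).
Proof. by move/nucleusP/(_ x y)=> []. Qed.

Lemma nucr n x y : n \in N -> (x * y) * n = x * (y * n).
Proof. by move/nucleusP/(_ x y)=> []. Qed.

Lemma nucleus1 : 1 \in N.
Proof. by apply/nucleusP=> x y; rewrite !mulg1 !mul1g. Qed.

Lemma nucleusM n m : n \in N -> m \in N -> n * m \in N.
Proof.
move=> nN mN; apply/nucleusP=> x y; split.
- by rewrite !(nucl _ _ nN) (nucl _ _ mN).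
- by rewrite -(nucm _ _ nN) (nucm _ _ mN) (nucm _ _ nN) (nucl _ _ nN).
- by rewrite -(nucr _ _ mN) (nucr _ _ nN) (nucr _ _ mN) (nucr _ _ mN).
Qed.

Hypothesis extraQ : extra_loop Q.

Let mulKV := mulKV extraQ.
Let mulK := mulK extraQ.
Let mulVK := mulVK extraQ.
Let mulKr := mulKr extraQ.
Let mulVl := mulVl extraQ.
Let linvK := linvK extraQ.
Let linvM := linvM extraQ.

(** In a loop with the inverse property the three nuclei coincide. *)
Lemma right_nuclear_nucleus n :
  (forall x y, (x * y) * n = x * (y * n)) -> n \in N.
Proof.
move=> nr; have mid := middle_of_right extraQ nr; apply/nucleusP=> x y; split=> //.
- have left u v : linv n * (u * v) = (linv n * u) * v.
    apply: (@loop_mulI _ (linv u * n)); rewrite /= -mid mulK.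
    have -> : linv n * u = linv (linv u * n) by rewrite linvM linvK.
    by rewrite mulKV.
  by apply: (@loop_mulI _ (linv n)); rewrite /= left !mulK.
- by rewrite (mid x (n * y)) mulK.
Qed.

Lemma square_nucleus x : x * x \in N.
Proof. by apply: right_nuclear_nucleus; apply: square_right_nuclear. Qed.

Lemma nucleusV n : n \in N -> linv n \in N.
Proof.
move=> nN; apply: right_nuclear_nucleus=> x y; apply: (@loop_Imul _ n) => /=.
by rewrite mulVK nucr // mulVK.
Qed.

(** Right conjugacy closure transports the right nuclear law along conjugation:
  conjugating the autotopism (1, R_n, R_n) by the one of x leaves the first
  component trivial. *)
Lemma nucleusJ n x : n \in N -> lconj n x \in N.
Proof.
move=> nN; have shift u v : (u * lconj v x) * lconj n x = u * lconj (v * n) x.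
  rewrite -(mulVK x u) -!(right_conjugacy_closed extraQ).
  by rewrite (nucr _ _ nN).
apply: right_nuclear_nucleus=> u v.
have -> : v = lconj ((x * v) * linv x) x.
  by apply: (@loop_mulI _ x); rewrite /= lconjE mulVK.
by rewrite shift; have := shift 1 ((x * v) * linv x); rewrite !mul1g => ->.
Qed.

(** Congruence modulo the nucleus, standing for equality in Q / N. *)
Definition eqN a b : Prop := exists2 n, n \in N & a = b * n.

Lemma eqN_refl a : eqN a a.
Proof. by exists 1; rewrite ?nucleus1 ?mulg1. Qed.

Lemma eqN_sym a b : eqN a b -> eqN b a.
Proof. by case=> n nN ->; exists (linv n); rewrite ?nucleusV ?mulKr. Qed.

Lemma eqN_trans b a c : eqN a b -> eqN b c -> eqN a c.
Proof.
by case=> n nN -> [m mN ->]; exists (m * n); rewrite ?nucleusM ?(nucm _ _ mN).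
Qed.

Lemma eqN_mul a a' b b' : eqN a a' -> eqN b b' -> eqN (a * b) (a' * b').
Proof.
case=> n nN -> [m mN ->]; have tN := nucleusJ b' nN.
exists (lconj n b' * m); first exact: nucleusM.
by rewrite -!(nucr _ _ mN) (nucm _ _ nN) -(lconjE n) -(nucr a' b').
Qed.

Lemma eqN_mull n a : n \in N -> eqN (n * a) a.
Proof. by move=> nN; exists (lconj n a); rewrite ?nucleusJ ?lconjE. Qed.

Lemma eqN_linv a : eqN (linv a) a.
Proof. by exists (linv a * linv a); rewrite ?square_nucleus ?mulKV. Qed.

(** Inversion is trivial modulo N and reverses products. *)
Lemma eqNC a b : eqN (a * b) (b * a).
Proof.
apply: eqN_trans (eqN_sym (eqN_linv _)) _.
by rewrite linvM; apply: eqN_mul; apply: eqN_linv.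
Qed.

Lemma left_alternative x w : x * (x * w) = (x * x) * w.
Proof.
have := right_alternative extraQ (linv x) (linv w).
by move/(congr1 (@linv Q)); rewrite !linvM !linvK.
Qed.

(** With commutativity and x x = 1 modulo N, the Moufang identity becomes this
  law, which makes Q / N associative. *)
Lemma eqN_mul_mul x y z : eqN ((x * y) * (x * z)) (y * z).
Proof.
apply: (@eqN_trans ((x * y) * (z * x))).
  by apply: eqN_mul (eqNC _ _); apply: eqN_refl.
rewrite moufang //; apply: eqN_trans (eqNC _ _) _.
by rewrite left_alternative; apply/eqN_mull/square_nucleus.
Qed.

Lemma eqNA x y z : eqN ((x * y) * z) (x * (y * z)).
Proof.
(* Write z as y (y^-1 z), then cancel y by the previous law. *)
rewrite -{1}(mulKV y z).
apply: (@eqN_trans ((y * x) * (y * (linv y * z)))).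
  by apply: eqN_mul (eqN_refl _); apply: eqNC.
apply: eqN_trans (eqN_mul_mul _ _ _) _.
by apply: eqN_mul (eqN_refl _) _; apply: eqN_mul (eqN_linv _) (eqN_refl _).
Qed.

Lemma eqNCA x y z : eqN (x * (y * z)) (y * (x * z)).
Proof.
apply: eqN_trans (eqN_sym (eqNA _ _ _)) _; apply: eqN_trans (eqNA _ _ _).
exact: eqN_mul (eqNC _ _) (eqN_refl _).
Qed.

(** * Associators *)

Local Notation "[ x , y , z ]" := (associator x y z).

Lemma associator_eq x y z a : (x * y) * z = (x * (y * z)) * a -> a = [x, y, z].
Proof. by move=> e; apply: ldiv_eq. Qed.

Lemma associator_nucleus x y z : [x, y, z] \in N.
Proof. by have [n nN /associator_eq <-] := eqNA x y z. Qed.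

Lemma assoc_mulNl n x y z : n \in N -> [n * x, y, z] = [x, y, z].
Proof.
move=> nN; apply/esym/associator_eq.
by rewrite !(nucl _ _ nN) associatorE.
Qed.

(** A nuclear factor can travel through all argument positions and leave on the
  left, so that associators depend only on classes modulo N. *)
Lemma assoc_shift12 n x y z : n \in N -> [x * n, y, z] = [x, n * y, z].
Proof. by move=> nN; rewrite /associator !(nucm _ _ nN) (nucl _ _ nN). Qed.

Lemma assoc_shift23 n x y z : n \in N -> [x, y * n, z] = [x, y, n * z].
Proof. by move=> nN; rewrite /associator -(nucr _ _ nN) !(nucm _ _ nN). Qed.

Lemma mulN_comm n x : n \in N -> exists2 m, m \in N & x * n = m * x.
Proof.
move=> nN; exists (lconj n (linv x)); rewrite ?nucleusJ //.
by rewrite lconjV // linvK mulVK.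
Qed.

Lemma assoc_eqN1 x x' y z : eqN x x' -> [x, y, z] = [x', y, z].
Proof. by case=> n /(mulN_comm x')[m mN ->] ->; rewrite assoc_mulNl. Qed.

Lemma assoc_eqN2 x y y' z : eqN y y' -> [x, y, z] = [x, y', z].
Proof.
case=> n /(mulN_comm y')[m mN ->] ->; rewrite -assoc_shift12 //.
by apply: assoc_eqN1; exists m.
Qed.

Lemma assoc_eqN3 x y z z' : eqN z z' -> [x, y, z] = [x, y, z'].
Proof.
case=> n /(mulN_comm z')[m mN ->] ->; rewrite -assoc_shift23 //.
by apply: assoc_eqN2; exists m.
Qed.

(** Both [x, y, z] n and n [x, y, z] measure (x y) (z n) against x (y z),
  because [x, y, z n] = [x, y, z]. *)
Lemma associatorC n x y z : n \in N -> [x, y, z] * n = n * [x, y, z].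
Proof.
move=> nN; have aN := associator_nucleus x y z.
apply: (@loop_mulI _ (x * (y * z))) => /=.
rewrite -(nucr _ _ nN) associatorE (nucr _ _ nN) -associatorE.
rewrite (@assoc_eqN3 x y (z * n) z); last by exists n.
by rewrite -!(nucr _ _ nN) (nucm _ _ nN).
Qed.

Local Notation "a ^ x" := (lconj a x) : group_scope.

Lemma lconj_mul a b x : a \in N -> b \in N -> (a * b) ^ x = a ^ x * b ^ x.
Proof.
move=> aN bN; apply: (@loop_mulI _ x); rewrite /= lconjE (nucl _ _ aN).
rewrite -(nucr _ _ (nucleusJ x bN)) lconjE.
by rewrite (nucl _ _ aN) lconjE.
Qed.

Lemma lconj_comp a x y : a \in N -> a ^ (x * y) = (a ^ x) ^ y.
Proof.
move=> aN; apply: (@loop_mulI _ (x * y)); rewrite /= lconjE -(nucl _ _ aN).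
rewrite -(lconjE a) (nucm _ _ (nucleusJ x aN)) -(lconjE _ y).
by rewrite (nucr _ _ (nucleusJ y (nucleusJ x aN))).
Qed.

Lemma lconj_fix a x : a * x = x * a -> a ^ x = a.
Proof. by move=> e; apply: (@loop_mulI _ x); rewrite /= lconjE. Qed.

Lemma lconj_eqN x y z u v : eqN u v -> [x, y, z] ^ u = [x, y, z] ^ v.
Proof.
case=> n nN ->; have aN := associator_nucleus x y z.
have [m mN ->] := mulN_comm v nN.
by rewrite lconj_comp // (lconj_fix (associatorC _ _ _ mN)).
Qed.

Lemma eqN_lconj w u : eqN (w ^ u) w.
Proof.
rewrite lconjV //; apply: eqN_trans (eqNA _ _ _) _.
rewrite -[X in eqN _ X](mulK u).
by apply: eqN_mul (eqN_refl _) (eqNC _ _).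
Qed.

(** The middle steps compute (w ^ x) ^ y and w ^ (x y), which differ by
  [w, x, y]; applying right conjugacy closure to ((z w) x) y and to
  (z w) (x y) compares the defects of z w with those of z and w. *)
Lemma associator_mul1 z w x y :
  [z * w, x, y] = [z, x, y] ^ w * [w, x, y].
Proof.
set fz := [z, x, y]; set fw := [w, x, y].
have [fzN fwN] : fz \in N /\ fw \in N by split; apply: associator_nucleus.
apply/esym/associator_eq.
have conj2 : (w ^ x) ^ y = w ^ (x * y) * fw.
  apply: (@loop_mulI _ (x * y)); rewrite /= -(nucr _ _ fwN) lconjE associatorE.
  by rewrite -(lconjE w x) (right_conjugacy_closed extraQ).
set t := w ^ (x * y) in conj2 *.
have -> : fz ^ w = fz ^ t by apply/lconj_eqN/eqN_sym/eqN_lconj.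
rewrite (right_conjugacy_closed extraQ x z w) (right_conjugacy_closed extraQ y).
rewrite conj2 (right_conjugacy_closed extraQ (x * y)) -/t -(associatorE z x y) -/fz.
rewrite -!(nucr _ _ fwN) (nucm _ _ fzN) -(lconjE fz t).
by rewrite (nucr _ _ (nucleusJ t fzN)).
Qed.

(** Since [x y, z, x] = [y, z, x], this compares the Moufang identity with the
  definition of [x, y, z]. *)
Lemma associator_rot_conj x y z : [y, z, x] = [x, y, z] ^ x.
Proof.
have aN := associator_nucleus x y z.
have xzx1 : [x, z, x] = 1.
  by apply/esym/associator_eq; rewrite mulg1 flexible.
have <- : [x * y, z, x] = [y, z, x].
  rewrite associator_mul1 xzx1.
  have -> : 1 ^ y = 1 by apply: lconj_fix; rewrite mulg1 mul1g.
  by rewrite mul1g.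
apply/esym/associator_eq; rewrite moufang // -(associatorE x y z).
by rewrite (nucm _ _ aN) -(lconjE [x, y, z] x) (nucr _ _ (nucleusJ x aN)).
Qed.

(** This is the expansion of [x x, y, z], where x x is nuclear. *)
Lemma associator_conjV x y z : [x, y, z] ^ x * [x, y, z] = 1.
Proof.
rewrite -associator_mul1 (@assoc_eqN1 _ 1); last first.
  by rewrite -[x * x]mulg1; apply/eqN_mull/square_nucleus.
by apply/esym/associator_eq; rewrite !mul1g mulg1.
Qed.

Lemma associator_rotV x y z : [y, z, x] = linv [x, y, z].
Proof.
apply: (@loop_Imul _ [x, y, z]).
by rewrite /= mulVl associator_rot_conj associator_conjV.
Qed.

(** Two rotations invert twice, and they make up one rotation backwards. *)
Lemma associator_rot x y z : [y, z, x] = [x, y, z].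
Proof.
by rewrite (associator_rotV z x y) (associator_rotV y z x) linvK.
Qed.

Lemma associator_sq x y z : [x, y, z] * [x, y, z] = 1.
Proof. by rewrite -{2}(associator_rot x y z) (associator_rotV x y z) mulV. Qed.

Lemma associator_fix1 x y z : [x, y, z] ^ x = [x, y, z].
Proof. by rewrite -associator_rot_conj associator_rot. Qed.

Lemma associator_fix2 x y z : [x, y, z] ^ y = [x, y, z].
Proof. by rewrite -associator_rot associator_fix1. Qed.

Lemma associator_fix3 x y z : [x, y, z] ^ z = [x, y, z].
Proof. by rewrite -associator_rot associator_fix2. Qed.

(** The commutator of w with [z, x, y] is symmetric in w and z, because
  z w and w z are congruent modulo N. *)
Lemma associator_swap_move z w x y :
  [z, x, y] ^ w * [z, x, y] = [w, x, y] ^ z * [w, x, y].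
Proof.
have fN t := associator_nucleus t x y.
have e : [z, x, y] ^ w * [w, x, y] = [w, x, y] ^ z * [z, x, y].
  by rewrite -!associator_mul1; apply/assoc_eqN1/eqNC.
apply: (@loop_Imul _ [w, x, y]) => /=; rewrite (nucr _ _ (fN w)).
rewrite (associatorC z x y (fN w)) -(nucr _ _ (fN z)) e.
by rewrite !(nucr _ _ (fN _)) !associator_sq.
Qed.

End Nucleus.

(** * Cosets and elementary abelian sections *)

Section Span.
Local Open Scope group_scope.
Variable Q : finLoopType.
Implicit Types (S T H : {set Q}) (u v : Q).

Definition lcoset u S : {set Q} := [set u * s | s in S].

Lemma card_lcoset u S : #|lcoset u S| = #|S|.
Proof. exact/card_imset/loop_mulI. Qed.

(** The last hypothesis replaces associativity: it makes the coset of t s equal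
  to that of t, so that the cosets partition T. *)
Lemma lagrange S T : 1 \in S ->
    {in T & S, forall t s, t * s \in T} ->
    {in T & S &, forall t s s', (t * s) * s' \in lcoset t S} ->
  #|T| = (#|[set lcoset t S | t in T]| * #|S|)%N.
Proof.
move=> S1 TS coset_S.
have memC t : t \in lcoset t S by apply/imsetP; exists 1; rewrite ?mulg1.
have same t s : t \in T -> s \in S -> lcoset (t * s) S = lcoset t S.
  move=> Tt Ss; apply/eqP; rewrite eqEcard !card_lcoset leqnn andbT.
  by apply/subsetP=> _ /imsetP[s' Ss' ->]; apply: coset_S.
apply: card_uniform_partition.
  by move=> _ /imsetP[t _ ->]; apply: card_lcoset.
apply/and3P; split.
- apply/eqP/setP=> t; apply/bigcupP/idP=> [[_ /imsetP[t' Tt' ->]] | Tt].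
    by case/imsetP=> s Ss ->; apply: TS.
  by exists (lcoset t S); first exact: imset_f.
- apply/trivIsetP=> _ _ /imsetP[t Tt ->] /imsetP[t' Tt' ->].
  apply: contraNT => /pred0Pn[v /andP[/imsetP[s Ss ->] /imsetP[s' Ss' e]]].
  by rewrite -(same t s) // -(same t' s') //= e.
- by apply/imsetP=> [[t _ e]]; have := memC t; rewrite -e inE.
Qed.

(** K / M is an elementary abelian 2-group.  The three laws are the ones needed
  to multiply elements h and u h of the set generated by u over H; for K = Q
  and M = N only congruences are available, for K inside N and M = 1 they are
  equalities. *)
Record elementary_mod (M K : {set Q}) : Prop := ElementaryMod {
  elementary_nuclear : M \subset nucleus Q;
  elementary_sub : M \subset K;
  elementary_mulM : forall m n, m \in M -> n \in M -> m * n \in M;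
  elementary_mulK : forall a b, a \in K -> b \in K -> a * b \in K;
  elementary_mulA : forall a b c, a \in K -> b \in K -> c \in K ->
    (a * b) * c \in lcoset (a * (b * c)) M;
  elementary_mulCA : forall a b c, a \in K -> b \in K -> c \in K ->
    a * (b * c) \in lcoset (b * (a * c)) M;
  elementary_sq : forall a b c, a \in K -> b \in K -> c \in K ->
    (a * b) * (a * c) \in lcoset (b * c) M
}.

(** Each generator u adds a single coset, since u u lies in M. *)
Fixpoint span (M : {set Q}) (us : seq Q) : {set Q} :=
  if us is u :: us' then span M us' :|: lcoset u (span M us') else M.

Section SpanTheory.
Variables M K : {set Q}.
Hypothesis elemK : elementary_mod M K.
Local Notation span := (span M).

Lemma span_min us H :
    M \subset H -> {subset us <= H} -> {in H &, forall a b, a * b \in H} ->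
  span us \subset H.
Proof.
move=> MH usH HH; elim: us usH => //= u us IH usH.
have sH : span us \subset H by apply: IH => v v_us; rewrite usH // inE v_us orbT.
rewrite subUset sH; apply/subsetP=> _ /imsetP[h /(subsetP sH) Hh ->].
by rewrite HH // usH // inE eqxx.
Qed.

Lemma notin_span u us H :
    M \subset H -> {subset us <= H} -> {in H &, forall a b, a * b \in H} ->
  u \notin H -> u \notin span us.
Proof. by move=> MH usH HH; apply/contraNN/subsetP/span_min. Qed.

Lemma sub_span us : M \subset span us.
Proof. by elim: us => //= u us IH; apply: subset_trans IH (subsetUl _ _). Qed.

Lemma span_mul us :
  {subset us <= K} -> {in span us &, forall a b, a * b \in span us}.
Proof.
case: elemK => MN MK M_mul K_mul mulA mulCA mul_sq.
elim: us => [_|u us IH usK]; first exact: M_mul.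
rewrite /=; set H := span us in IH *.
have Ku : u \in K by rewrite usK // inE eqxx.
have usK' : {subset us <= K} by move=> v v_us; rewrite usK // inE v_us orbT.
have HH := IH usK'; have HK : {subset H <= K} by apply/subsetP/span_min.
have MH : {subset M <= H} by apply/subsetP/sub_span.
have satH v t : t \in H -> v \in lcoset t M -> v \in H.
  by move=> Ht /imsetP[m /MH Hm ->]; apply: HH.
have satU v t : t \in H -> v \in lcoset (u * t) M -> v \in lcoset u H.
  move=> Ht /imsetP[m Mm ->]; rewrite (nucr _ _ (subsetP MN _ Mm)).
  by apply/imset_f/HH => //; apply: MH.
move=> a b /setUP[Ha | /imsetP[h Hh ->]] /setUP[Hb | /imsetP[k Hk ->]].
- by rewrite inE HH.
- have e := mulCA a u k (HK _ Ha) Ku (HK _ Hk).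
  by rewrite inE (satU _ _ (HH _ _ Ha Hk) e) orbT.
- have e := mulA u h b Ku (HK _ Hh) (HK _ Hb).
  by rewrite inE (satU _ _ (HH _ _ Hh Hb) e) orbT.
- have e := mul_sq u h k Ku (HK _ Hh) (HK _ Hk).
  by rewrite inE (satH _ _ (HH _ _ Hh Hk) e).
Qed.

(** If u h were in the span H for some h in H, then, as right multiplication by
  h permutes the finite set H, u would be in H. *)
Lemma card_span_cons u us : {subset us <= K} -> u \notin span us ->
  #|span (u :: us)| = (2 * #|span us|)%N.
Proof.
move=> usK; rewrite /=; set H := span us => uH.
have HH : {in H &, forall a b, a * b \in H} := span_mul usK.
rewrite cardsU card_lcoset mul2n -addnn disjoint_setI0 ?cards0 ?subn0 //.
apply/pred0P=> v /=; apply: contraNF uH => /andP[Hv /imsetP[h Hh vE]].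
have HhE : [set k * h | k in H] = H.
  apply/eqP; rewrite eqEcard card_imset ?leqnn ?andbT; last exact: loop_Imul.
  by apply/subsetP=> _ /imsetP[k Hk ->]; apply: HH.
by move: Hv; rewrite -{1}HhE vE => /imsetP[k Hk /loop_Imul->].
Qed.

End SpanTheory.
End Span.

(** * Counting with a noncentral associator *)

Section Count.
Local Open Scope group_scope.
Variable Q : finLoopType.
Hypothesis extraQ : extra_loop Q.
Implicit Types a b n u v w x y z : Q.
Local Notation N := (nucleus Q).
Local Notation A := (associator_subloop Q).
Local Notation "[ x , y , z ]" := (associator x y z).
Local Notation "a ^ x" := (lconj a x) : group_scope.

(** The two sides of the action of Q on N; both kinds of set are closed under
  multiplication, so they separate an element from a span. *)
Definition fixers a : {set Q} := [set u | a ^ u == a].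
Definition nuclear_fixed u : {set Q} := [set n in N | n ^ u == n].

Lemma fixers_mul a : a \in N -> {in fixers a &, forall u v, u * v \in fixers a}.
Proof.
move=> aN u v; rewrite !inE => /eqP au /eqP av.
by rewrite (lconj_comp extraQ) // au av.
Qed.

Lemma nuclear_fixedP n u : reflect (n \in N /\ n ^ u = n) (n \in nuclear_fixed u).
Proof. by apply: (iffP setIdP) => [][nN /eqP]. Qed.

Lemma nuclear_fixed_mul u :
  {in nuclear_fixed u &, forall m n, m * n \in nuclear_fixed u}.
Proof.
move=> m n /nuclear_fixedP[mN mu] /nuclear_fixedP[nN nu].
by apply/nuclear_fixedP; rewrite nucleusM // (lconj_mul extraQ) // mu nu.
Qed.

Lemma nucleus_fixers x y z : N \subset fixers [x, y, z].
Proof. by apply/subsetP=> n nN; rewrite inE lconj_fix // associatorC. Qed.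

Lemma associator_in x y z : [x, y, z] \in A.
Proof.
apply: (subsetP (sub_subloop_gen _)); rewrite inE.
by apply/existsP; exists x; apply/existsP; exists y; apply/existsP; exists z.
Qed.

Lemma associator_subloop_mul : {in A &, forall a b, a * b \in A}.
Proof.
case/andP: (subloop_genP (associators Q)) => _ /forall_inP AA a b Aa Ab.
by have /forall_inP/(_ b Ab)/and3P[] := AA a Aa.
Qed.

(** The identity is included, so that this is the largest elementary abelian
  2-subgroup of the center of N. *)
Definition central_involutions : {set Q} :=
  [set a in N | (a * a == 1) && [forall n in N, a * n == n * a]].

Lemma central_involutionsP a :
  reflect [/\ a \in N, a * a = 1 & {in N, forall n, a * n = n * a}]
          (a \in central_involutions).
Proof.
apply: (iffP setIdP) => [[aN /andP[/eqP aa /forall_inP aC]] | [aN aa aC]].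
  by split=> // n /aC/eqP.
by rewrite aa eqxx; split=> //; apply/forall_inP=> n /aC->.
Qed.

Lemma central_involutions_mul :
  {in central_involutions &, forall a b, a * b \in central_involutions}.
Proof.
move=> a b /central_involutionsP[aN aa aC] /central_involutionsP[bN bb bC].
apply/central_involutionsP; split; first exact: nucleusM.
  by rewrite {1}(aC _ bN) (nucl _ _ bN) -(nucl _ _ aN) aa mul1g bb.
move=> n nN; rewrite (nucl _ _ aN) (bC _ nN) -(nucl _ _ aN) (aC _ nN).
by rewrite (nucl _ _ nN).
Qed.

Lemma associator_central_involution x y z : [x, y, z] \in central_involutions.
Proof.
apply/central_involutionsP; split; first exact: associator_nucleus.
  exact: associator_sq.
by move=> n; apply: associatorC.
Qed.

Lemma central_involutions_elementary :
  elementary_mod [set 1] central_involutions.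
Proof.
have cos1 u v : u = v -> u \in lcoset v [set 1].
  by move->; apply/imsetP; exists 1; rewrite ?set11 ?mulg1.
split; rewrite ?sub1set ?set11 ?nucleus1 //.
- by apply/central_involutionsP; split=> [||n _]; rewrite ?nucleus1 ?mul1g ?mulg1.
- by move=> m n /set1P-> /set1P->; rewrite mul1g set11.
- exact: central_involutions_mul.
- move=> a b c /central_involutionsP[aN _ _] _ _.
  exact/cos1/nucl.
- move=> a b c /central_involutionsP[aN _ aC] /central_involutionsP[bN _ _] _.
  by apply: cos1; rewrite -(nucl _ _ aN) (aC _ bN) (nucl _ _ bN).
- move=> a b c /central_involutionsP[aN aa aC] /central_involutionsP[bN _ _] _.
  by apply: cos1; rewrite (aC _ bN) (nucl _ _ bN) -(nucl a c aN) aa mul1g.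
Qed.

Lemma nucleus_elementary : elementary_mod N [set: Q].
Proof.
split=> //.
- exact: nucleusM.
- by move=> a b _ _; apply: in_setT.
- by move=> a b c _ _ _; apply/imsetP/eqNA.
- by move=> a b c _ _ _; apply/imsetP/eqNCA.
- by move=> a b c _ _ _; apply/imsetP/eqN_mul_mul.
Qed.

Lemma associator_fix_swap x y z w :
  [z, x, y] ^ w = [z, x, y] -> [w, x, y] ^ z = [w, x, y].
Proof.
move=> e; have := associator_swap_move extraQ z w x y.
rewrite e associator_sq // => /esym e'.
by apply: (@loop_Imul _ [w, x, y]); rewrite /= e' associator_sq.
Qed.

Section Noncentral.
Variables x y z w : Q.
Hypothesis moves : w \notin fixers [x, y, z].

Lemma moves_x : x \notin fixers [w, y, z].
Proof. by apply: contraNN moves; rewrite !inE => /eqP/associator_fix_swap->. Qed.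

Lemma moves_y : y \notin fixers [w, z, x].
Proof.
apply: contraNN moves; rewrite !inE -(associator_rot extraQ x y z).
by move/eqP/associator_fix_swap->.
Qed.

Lemma moves_z : z \notin fixers [w, x, y].
Proof.
apply: contraNN moves; rewrite !inE (associator_rot extraQ z x y).
by move/eqP/associator_fix_swap->.
Qed.

(** Each of x, y, z, w moves an associator that all later ones, and N, fix. *)
Lemma nucleus_index_dvd : 16 * #|N| %| #|Q|.
Proof.
have cons u us := card_span_cons nucleus_elementary (fun v _ => in_setT v)
  : u \notin span N us -> #|span N (u :: us)| = (2 * #|span N us|)%N.
have outside t a b c us : t \notin fixers [a, b, c] ->
    {subset us <= fixers [a, b, c]} -> t \notin span N us.
  move=> t_moves us_fix; apply: notin_span t_moves => //.
    exact: nucleus_fixers.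
  exact/fixers_mul/associator_nucleus.
have spanE : #|span N [:: x; y; z; w]| = (16 * #|N|)%N.
  rewrite !cons ?mulnA //.
  - by apply: outside moves _.
  - apply: outside moves_z _ => u; rewrite !inE => /eqP->.
    by rewrite associator_fix1.
  - apply: outside moves_y _ => u; rewrite !inE => /orP[]/eqP->.
      by rewrite associator_fix2.
    by rewrite associator_fix1.
  - apply: outside moves_x _ => u; rewrite !inE => /or3P[]/eqP->.
    + by rewrite associator_fix2.
    + by rewrite associator_fix3.
    + by rewrite associator_fix1.
set S := span N [:: x; y; z; w] in spanE.
have SM : {in S &, forall a b, a * b \in S}.
  by apply: (span_mul nucleus_elementary) => v _; apply: in_setT.
have NS : {subset N <= S} by apply/subsetP/sub_span.
rewrite -spanE -cardsT (@lagrange _ S setT) ?dvdn_mull //.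
- exact/NS/nucleus1.
- by move=> t s _ _; apply: in_setT.
move=> t s s' _ Ss Ss'; have [n nN ->] := eqNA extraQ t s s'.
by rewrite (nucr _ _ nN); apply/imset_f/SM; [apply: SM | apply: NS].
Qed.

(* The value common to the four commutators. *)
Let g := [x, y, z] ^ w * [x, y, z].

(** By [associator_mul1], g is a product of three associators. *)
Lemma moved_commutator_in : (g \in central_involutions) /\ (g \in A).
Proof.
have -> : g = ([x * w, y, z] * [w, y, z]) * [x, y, z].
  rewrite associator_mul1 // (nucr _ _ (associator_nucleus extraQ w y z)).
  by rewrite associator_sq // mulg1.
have [Zf Af] := (associator_central_involution, associator_in).
split; first by rewrite !central_involutions_mul.
by rewrite !associator_subloop_mul.
Qed.

(** A commutator a ^ t a of an involution a is fixed by t, as t t acts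
  trivially; by [associator_swap_move], g is such a commutator for each of the
  four elements. *)
Lemma moved_commutator_fixed :
  [/\ g \in nuclear_fixed x, g \in nuclear_fixed y,
      g \in nuclear_fixed z & g \in nuclear_fixed w].
Proof.
have norm_fixed a b c t : [a, b, c] ^ t * [a, b, c] \in nuclear_fixed t.
  have aN := associator_nucleus extraQ a b c; have atN := nucleusJ extraQ t aN.
  have aC := associatorC extraQ a b c.
  apply/nuclear_fixedP; split; first exact: nucleusM.
  rewrite lconj_mul // -lconj_comp //.
  by rewrite (lconj_fix (aC _ (square_nucleus extraQ t))) (aC _ atN).
split.
- have -> : g = [w, y, z] ^ x * [w, y, z] by apply: associator_swap_move.
  exact: norm_fixed.
- have -> : g = [w, z, x] ^ y * [w, z, x].
    by rewrite /g -(associator_rot extraQ x y z); apply: associator_swap_move.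
  exact: norm_fixed.
- have -> : g = [w, x, y] ^ z * [w, x, y].
    by rewrite /g (associator_rot extraQ z x y); apply: associator_swap_move.
  exact: norm_fixed.
- exact: norm_fixed.
Qed.

(** Each associator is moved by the missing element, which fixes all later
  generators. *)
Lemma card_associators_span : (32 <= #|A|) && (32 %| #|N|).
Proof.
have [gZ gA] := moved_commutator_in; have [gx gy gz gw] := moved_commutator_fixed.
have fixed t a b c : t \in [:: a; b; c] -> [a, b, c] \in nuclear_fixed t.
  move=> t_in; apply/nuclear_fixedP; split; first exact: associator_nucleus.
  move: t_in; rewrite !inE => /or3P[]/eqP->.
  - exact: associator_fix1.
  - exact: associator_fix2.
  - exact: associator_fix3.
pose us := [:: [w, y, z]; [w, z, x]; [w, x, y]; [x, y, z]; g].
have usZ : {subset us <= central_involutions}.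
  by apply/allP; rewrite /= !associator_central_involution gZ.
have usA : {subset us <= A}.
  by apply/allP; rewrite /= !associator_in gA.
have fixed1 t : [set 1] \subset nuclear_fixed t.
  rewrite sub1set; apply/nuclear_fixedP; split; first exact: nucleus1.
  by apply: lconj_fix; rewrite mul1g mulg1.
have outside a b c t vs : t \notin fixers [a, b, c] ->
    {subset vs <= nuclear_fixed t} -> [a, b, c] \notin span [set 1] vs.
  move=> t_moves vs_fix; apply: (@notin_span _ _ _ _ (nuclear_fixed t)) => //.
    exact: nuclear_fixed_mul.
  by apply: contraNN t_moves => /nuclear_fixedP[_ /eqP]; rewrite inE.
have g_neq1 : g \notin [set 1].
  apply: contraNN moves; rewrite !inE => /eqP g1; apply/eqP.
  by apply: (@loop_Imul _ [x, y, z]); rewrite /= associator_sq.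
have cardS : #|span [set 1] us| = 32.
  have cons u vs := @card_span_cons _ _ _ central_involutions_elementary u vs.
  have Zf := associator_central_involution.
  have [[tx ty] tz] := (moves_x, moves_y, moves_z).
  rewrite /us !cons //; try by apply/allP; rewrite /= ?Zf ?gZ.
  - by rewrite /= cards1.
  - by apply: outside moves _; apply/allP; rewrite /= gw.
  - by apply: outside tz _; apply/allP; rewrite /= gz fixed // !inE eqxx ?orbT.
  - by apply: outside ty _; apply/allP; rewrite /= gy !fixed // !inE eqxx ?orbT.
  - by apply: outside tx _; apply/allP; rewrite /= gx !fixed // !inE eqxx ?orbT.
set S := span [set 1] us in cardS.
have SA : S \subset A.
  apply: span_min usA associator_subloop_mul; rewrite sub1set.
  by case/andP: (subloop_genP (associators Q)).
have SZ : {subset S <= central_involutions}.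
  apply/subsetP; apply: span_min usZ central_involutions_mul.
  exact: elementary_sub central_involutions_elementary.
have SN : {subset S <= N} by move=> s /SZ/central_involutionsP[].
have SM : {in S &, forall a b, a * b \in S}.
  exact: (span_mul central_involutions_elementary).
rewrite -{1}cardS subset_leq_card //= -cardS (@lagrange _ S N) ?dvdn_mull //.
- by apply: (subsetP (sub_span _ us)); rewrite set11.
- by move=> n s nN Ss; rewrite nucleusM // SN.
- by move=> n s s' nN Ss Ss'; rewrite (nucl _ _ nN); apply/imset_f/SM.
Qed.

End Noncentral.
End Count.

Theorem theorem6p6 (Q : finLoopType) (extraQ : extra_loop Q)
    (noncentral_assoc : exists x y z : Q, associator x y z \notin center Q) :
  [/\ 32 <= #|associator_subloop Q|,
      16 <= loop_index (nucleus Q)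
    & 512 %| #|Q|].
Proof.
have [x [y [z]]] := noncentral_assoc.
(* Associators are nuclear, so failure of centrality is failure to commute. *)
rewrite inE associator_nucleus //= => /forallPn[w aw].
have moves : w \notin fixers (associator x y z).
  by apply: contraNN aw; rewrite inE => /eqP e; rewrite -lconjE e.
have /andP[A32 N32] := card_associators_span extraQ moves.
have Q16 := nucleus_index_dvd extraQ moves.
have N_gt0 : 0 < #|nucleus Q| by apply/card_gt0P; exists 1%g; apply: nucleus1.
have indexE : #|Q| = loop_index (nucleus Q) * #|nucleus Q|.
  rewrite -cardsT (@lagrange _ (nucleus Q) setT) ?nucleus1 //.
  - congr (_ * _); apply: eq_card => S.
    by apply/imsetP/imsetP=> [][t _ ->]; exists t; rewrite ?in_setT.
  - by move=> t n _ _; apply: in_setT.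
  - move=> t m n _ mN nN; rewrite (nucr _ _ nN).
    exact/imset_f/nucleusM.
split=> //; last first.
  by apply: dvdn_trans Q16; rewrite (@dvdn_pmul2l 16 32).
move: Q16; rewrite indexE dvdn_pmul2r //; apply: dvdn_leq.
have : 0 < #|Q| by apply/card_gt0P; exists 1%g.
by rewrite indexE muln_gt0 => /andP[].
Qed.
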